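(* Let $W$ be an instance of MAXCUT with maximal cut $(S,\bar S)$. Let $v=\delta_S$ and let $D$ be the diagonal matrix with $D_{ii}=-v_i\sum_jW_{ij}v_j$. The following are equivalent: \begin{enumerate} \item $W$ is GW-bipolar; \item $\delta_S$ is a generalized least eigenvector of $W$; \item $W+D\succeq0$; \item the optimum of the dual GW problem (maximize $\sum_iE_{ii}$ over diagonal $E$ with $W-E\succeq0$) is attained at $E=-D$. \end{enumerate}
   Context: An instance of MAXCUT is a non-negative symmetric $n\times n$ matrix $W$ with zero diagonal and connected support; a maximal cut $(S,\bar S)$ of $\{1,\dots,n\}$ maximizes $\sum_{i\in S,j\notin S}W_{ij}$. The characteristic vector of the cut is $\delta_S\in\{1,-1\}^n$ with $(\delta_S)_i=1$ for $i\in S$ and $-1$ otherwise. A vector $u$ is a generalized least eigenvector of $W$ if $u$ is an eigenvector of $W+\Delta$ for its least eigenvalue, for some diagonal $\Delta$. The primal GW problem is: minimize $\sum_{i,j}P_{ij}W_{ij}$ subject to $P\succeq0$ and $P_{ii}=1$ for all $i$. $W$ is GW-bipolar if some optimal solution of the primal GW problem has the form $uu^T$ with $u\in\{-1,1\}^n$. *)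

(* Defs.v *)
From HB Require Import structures.
From mathcomp Require Import all_boot all_order all_algebra.
From mathcomp Require Import reals.
Set Implicit Arguments. Unset Strict Implicit. Unset Printing Implicit Defensive.
Import Order.TTheory GRing.Theory Num.Theory.
Local Open Scope ring_scope.

Section GW.
Variable R : realType.
Variable n : nat.

Definition maxcut_instance (W : 'M[R]_n) : Prop :=
  W^T = W /\ (forall i j, 0 <= W i j) /\ (forall i, W i i = 0) /\
  (forall i j, connect (fun a b => 0 < W a b) i j).

Definition cut_value (W : 'M[R]_n) (S : {set 'I_n}) : R :=
  \sum_(i in S) \sum_(j in ~: S) W i j.

Definition is_max_cut (W : 'M[R]_n) (S : {set 'I_n}) : Prop :=
  forall T : {set 'I_n}, cut_value W T <= cut_value W S.

Definition char_vec (S : {set 'I_n}) : 'cV[R]_n :=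
  \col_i (if i \in S then 1 else -1).

Definition psd (A : 'M[R]_n) : Prop :=
  A^T = A /\ forall x : 'cV[R]_n, 0 <= (x^T *m A *m x) 0 0.

Definition least_eigenvector (A : 'M[R]_n) (u : 'cV[R]_n) : Prop :=
  u != 0 /\ exists lam : R, A *m u = lam *: u /\
    forall (mu : R) (x : 'cV[R]_n), x != 0 -> A *m x = mu *: x -> lam <= mu.

Definition generalized_least_eigenvector (W : 'M[R]_n) (u : 'cV[R]_n) : Prop :=
  exists d : 'rV[R]_n, least_eigenvector (W + diag_mx d) u.

Definition gw_objective (W P : 'M[R]_n) : R := \sum_i \sum_j P i j * W i j.

Definition gw_feasible (P : 'M[R]_n) : Prop := psd P /\ forall i, P i i = 1.

Definition gw_primal_optimal (W P : 'M[R]_n) : Prop :=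
  gw_feasible P /\ forall Q, gw_feasible Q -> gw_objective W P <= gw_objective W Q.

Definition gw_bipolar (W : 'M[R]_n) : Prop :=
  exists u : 'cV[R]_n, (forall i, u i 0 = 1 \/ u i 0 = -1) /\
    gw_primal_optimal W (u *m u^T).

Definition gw_dual_optimal (W : 'M[R]_n) (E : 'M[R]_n) : Prop :=
  is_diag_mx E /\ psd (W - E) /\
  forall E' : 'M[R]_n, is_diag_mx E' -> psd (W - E') -> \tr E' <= \tr E.

Definition D_of (W : 'M[R]_n) (v : 'cV[R]_n) : 'M[R]_n :=
  diag_mx (\row_i (- v i 0 * \sum_j W i j * v j 0)).

End GW.

(* Main.v *)
(* Write D for the diagonal matrix determined by (W + D) v = 0, so that v v^T has
   primal objective -tr D. Any shift W + Delta - lam having v in its kernel equals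
   W + D, which turns least eigenvectors into semidefiniteness. If W + D is
   semidefinite, then tr (Q W) = tr (Q (W + D)) - tr D >= -tr D for every feasible
   Q, and dually tr E <= v^T W v for every feasible E.
   For bipolar => semidefinite, no strong duality is needed. Maximality of the cut
   makes v v^T itself optimal; if x^T (W + D) x < 0, tilt the one-dimensional
   embedding v into the plane, i |-> (v_i cos th_i, sin th_i) with
   sin th_i = sqrt tau x_i. The objective changes by
   tau x^T (W + D) x + O(tau^2), contradicting optimality for small tau. *)
Require Import Defs.
From HB Require Import structures.
From mathcomp Require Import all_boot all_order all_algebra.
From mathcomp Require Import reals complex ring lra.
Import Order.TTheory GRing.Theory Num.Theory.
Local Open Scope ring_scope.

(** * Spectral decomposition of real symmetric matrices and the semidefinite cone *)

Section SemidefiniteObjective.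
Set Implicit Arguments. Unset Strict Implicit.

(* The eigenvectors [a k] and [b k] are the real and imaginary parts of the rows of
   a unitary matrix diagonalizing [A] over [R[i]]. *)
Lemma symmetric_eigen_decomposition (R : rcfType) (n : nat) (A : 'M[R]_n) :
  A^T = A ->
  exists (d : 'I_n -> R) (a b : 'I_n -> 'cV[R]_n),
    [/\ A = \sum_k d k *: (a k *m (a k)^T + b k *m (b k)^T),
        forall k, A *m a k = d k *: a k,
        forall k, A *m b k = d k *: b k &
        forall k, (a k != 0) || (b k != 0)].
Proof.
move=> symA.
pose AC : 'M[R[i]]_n := map_mx (real_complex R) A.
have AC_herm : AC \is hermsymmx.
  apply/is_hermitianmxP; rewrite expr0 scale1r.
  rewrite map_trmx -map_mx_comp.
  apply/matrixP => i j; rewrite !mxE /= -[in RHS]symA mxE.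
  by apply/esym/CrealP/complex_realP; exists (A i j).
pose P := spectralmx AC.
pose sp := spectral_diag AC.
have P_unitary : P \is unitarymx by exact: spectral_unitarymx.
have AC_eq : AC = invmx P *m diag_mx sp *m P.
  by apply/orthomx_spectralP; apply: hermitian_normalmx AC_herm.
have sp_real k : sp 0 k = (complex.Re (sp 0 k))%:C%C.
  rewrite RRe_real //.
  by have /mxOverP/(_ 0 k) := @hermitian_spectral_diag_real _ _ AC AC_herm.
have ReD : {morph (@complex.Re R) : x y / x + y} by case=> ? ? [].
have ImD : {morph (@complex.Im R) : x y / x + y} by case=> ? ? [].
have ReZ r x : complex.Re (r%:C%C * x) = r * complex.Re x.
  by case: x => x y /=; rewrite mul0r subr0.
have ImZ r x : complex.Im (r%:C%C * x) = r * complex.Im x.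
  by case: x => x y /=; rewrite mul0r addr0.
have PAC : P *m AC = diag_mx sp *m P.
  by rewrite AC_eq -mulmxA mulKVmx // spectral_unit.
(* The rows of [P] are left eigenvectors with real eigenvalues, so real and imaginary parts
   separate; symmetry of [A] turns them into column eigenvectors. *)
have eigrow k i : \sum_j P k j * (A j i)%:C%C = (complex.Re (sp 0 k))%:C%C * P k i.
  have /matrixP/(_ k i) := PAC.
  rewrite -sp_real mul_diag_mx !mxE => <-.
  by apply: eq_bigr => j _; rewrite !mxE.
exists (fun k => complex.Re (sp 0 k)), (fun k => \col_i complex.Re (P k i)),
  (fun k => \col_i complex.Im (P k i)); split.
(* The inverse of [P] is its conjugate transpose, and the real part of [conj(z) * w] is
   [Re z * Re w + Im z * Im w]. *)
- rewrite invmx_unitary // in AC_eq.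
  apply/matrixP => i j.
  have /matrixP/(_ i j)/(congr1 (@complex.Re R)) := AC_eq.
  rewrite !mxE (big_morph _ ReD (erefl : complex.Re 0 = 0)) summxE /= => ->.
  apply: eq_bigr => k _.
  rewrite mul_mx_diag !mxE !big_ord1 !mxE sp_real /=.
  case: (P k i) (P k j) => [x1 y1] [x2 y2] /=.
  ring.
- move=> k; apply/colP => i; rewrite !mxE.
  have /(congr1 (@complex.Re R)) := eigrow k i.
  rewrite (big_morph _ ReD (erefl : complex.Re 0 = 0)) ReZ => <-.
  by apply: eq_bigr => j _; rewrite mxE [_ * _%:C%C]mulrC ReZ -[in LHS]symA mxE.
- move=> k; apply/colP => i; rewrite !mxE.
  have /(congr1 (@complex.Im R)) := eigrow k i.
  rewrite (big_morph _ ImD (erefl : complex.Im 0 = 0)) ImZ => <-.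
  by apply: eq_bigr => j _; rewrite mxE [_ * _%:C%C]mulrC ImZ -[in LHS]symA mxE.
(* If both parts vanished, row [k] of [P] would be zero, yet rows of a unitary matrix have norm
   1. *)
- move=> k; rewrite -negb_and; apply/negP => /andP[/eqP/colP a0 /eqP/colP b0].
  have /unitarymxP/matrixP/(_ k k) := P_unitary.
  rewrite !mxE eqxx big1 ?mulr1n => [/eqP|j _].
    by rewrite eq_sym oner_eq0.
  have := a0 j; have := b0 j; rewrite !mxE.
  by case: (P k j) => x y /= -> ->; rewrite mul0r.
Qed.

Variables (R : realType) (n : nat).
Implicit Types (A M P Q W : 'M[R]_n) (x : 'cV[R]_n).

Lemma gw_objectiveE W P : gw_objective W P = \tr (P *m W^T).
Proof.
by apply: eq_bigr => i _; rewrite mxE; apply: eq_bigr => j _; rewrite mxE.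
Qed.

Lemma gw_objectiveDl A M P :
  gw_objective (A + M) P = gw_objective A P + gw_objective M P.
Proof. by rewrite !gw_objectiveE linearD /= mulmxDr linearD. Qed.

Lemma gw_objectiveNl A P : gw_objective (- A) P = - gw_objective A P.
Proof. by rewrite !gw_objectiveE linearN /= mulmxN linearN. Qed.

Lemma gw_objective_diag A P : is_diag_mx A -> (forall i, P i i = 1) ->
  gw_objective A P = \tr A.
Proof.
move=> /is_diag_mxP diagA P1; apply: eq_bigr => i _.
rewrite (bigD1 i) //= P1 mul1r big1 ?addr0 // => j ji.
by rewrite diagA ?mulr0 // eq_sym.
Qed.

Lemma outerE x i j : (x *m x^T) i j = x i 0 * x j 0.
Proof. by rewrite mxE big_ord1 mxE. Qed.

Lemma quadratic_formE A x : (x^T *m A *m x) 0 0 = gw_objective A (x *m x^T).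
Proof.
rewrite gw_objectiveE -mxtrace_tr !trmx_mul !trmxK mulmxA mxtrace_mulC.
by rewrite mulmxA trace_mx11.
Qed.

Lemma col_sqnorm_gt0 x : x != 0 -> 0 < (x^T *m x) 0 0.
Proof.
move=> x0; rewrite lt_def; apply/andP; split; last first.
  by rewrite mxE sumr_ge0 // => i _; rewrite mxE -expr2 sqr_ge0.
apply: contra x0 => /eqP; rewrite mxE => /eqP.
rewrite psumr_eq0 => [/allP xx0|i _]; last by rewrite mxE -expr2 sqr_ge0.
apply/eqP/colP => i; have := xx0 i (mem_index_enum _).
by rewrite !mxE -expr2 sqrf_eq0 => /eqP.
Qed.

Lemma psdD A M : psd A -> psd M -> psd (A + M).
Proof.
move=> [sA pA] [sM pM]; split=> [|x]; first by rewrite linearD /= sA sM.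
by rewrite mulmxDr mulmxDl mxE addr_ge0.
Qed.

Lemma psdZ (a : R) A : 0 <= a -> psd A -> psd (a *: A).
Proof.
move=> a0 [sA pA]; split=> [|x]; first by rewrite linearZ /= sA.
by rewrite -scalemxAr -scalemxAl mxE mulr_ge0.
Qed.

Lemma psd_outer x : psd (x *m x^T).
Proof.
split=> [|y]; first by rewrite trmx_mul trmxK.
rewrite mulmxA -mulmxA -[y^T *m x]trmxK trmx_mul trmxK mxE big_ord1.
by rewrite mxE -expr2 sqr_ge0.
Qed.

Lemma psd_sum I (r : seq I) (F : I -> 'M[R]_n) :
  (forall k, psd (F k)) -> psd (\sum_(k <- r) F k).
Proof.
move=> pF; apply: (big_ind (@psd R n)) => //; last exact: psdD.
split=> [|x]; first by rewrite trmx0.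
by rewrite mulmx0 mul0mx mxE.
Qed.

Lemma psd_eigenvalue_ge0 A x (mu : R) :
  psd A -> x != 0 -> A *m x = mu *: x -> 0 <= mu.
Proof.
move=> [_ /(_ x) pA] x0 Ax; move: pA.
by rewrite -mulmxA Ax -scalemxAr mxE pmulr_lge0 // col_sqnorm_gt0.
Qed.

(** One of [a k], [b k] is nonzero, so each [d k] is a genuine eigenvalue and inherits the sign
    condition. *)
Lemma symmetric_nonneg_decomposition A : A^T = A ->
  (forall (mu : R) x, x != 0 -> A *m x = mu *: x -> 0 <= mu) ->
  exists (d : 'I_n -> R) (a b : 'I_n -> 'cV[R]_n),
    (forall k, 0 <= d k) /\
    A = \sum_k d k *: (a k *m (a k)^T + b k *m (b k)^T).
Proof.
move=> symA eigA.
have [d [a [b [eqA Aa Ab ab0]]]] := symmetric_eigen_decomposition symA.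
exists d, a, b; split=> // k.
by case/orP: (ab0 k) => [/eigA|/eigA]; apply.
Qed.

Lemma psd_of_eigenvalues A : A^T = A ->
  (forall (mu : R) x, x != 0 -> A *m x = mu *: x -> 0 <= mu) -> psd A.
Proof.
move=> symA /(symmetric_nonneg_decomposition symA) [d [a [b [d0 ->]]]].
by apply: psd_sum => k; apply: psdZ => //; apply: psdD; apply: psd_outer.
Qed.

(** Splitting [Q] into nonnegative multiples of rank-one matrices reduces the pairing to values of
    the quadratic form of [M]. *)
Lemma psd_objective_ge0 M Q : psd M -> psd Q -> 0 <= gw_objective M Q.
Proof.
move=> pM pQ; have [symQ _] := pQ.
have [d [a [b [d0 ->]]]] := symmetric_nonneg_decomposition symQ
  (fun mu x => @psd_eigenvalue_ge0 Q x mu pQ).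
rewrite gw_objectiveE mulmx_suml linear_sum /=; apply: sumr_ge0 => k _.
rewrite -scalemxAl linearZ /= mulmxDl linearD /= -!gw_objectiveE.
rewrite -!quadratic_formE mulr_ge0 ?addr_ge0 //; by case: pM.
Qed.

End SemidefiniteObjective.

(** * Sign vectors, cuts, and the perturbation argument *)

Section SignVectors.
Set Implicit Arguments. Unset Strict Implicit.
Variables (R : realType) (n : nat).
Implicit Types (W : 'M[R]_n) (u v : 'cV[R]_n) (S T : {set 'I_n}).

Definition sign_vector v := forall i, v i 0 = 1 \/ v i 0 = -1.

Lemma sign_vector_sqr v i : sign_vector v -> v i 0 * v i 0 = 1.
Proof. by case/(_ i) => ->; rewrite ?mulrNN mulr1. Qed.

Lemma sign_char_vec S : sign_vector (char_vec R S).
Proof. by move=> i; rewrite mxE; case: ifP; [left | right]. Qed.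

Lemma sign_vector_feasible v : sign_vector v -> gw_feasible (v *m v^T).
Proof.
move=> sv; split=> [|i]; first exact: psd_outer.
by rewrite outerE sign_vector_sqr.
Qed.

Lemma D_of_kernel W v : sign_vector v -> (W + D_of W v) *m v = 0.
Proof.
move=> sv; apply/colP => i; rewrite mulmxDl mul_diag_mx !mxE.
by rewrite mulrAC mulNr sign_vector_sqr // mulN1r subrr.
Qed.

Lemma D_of_objective W v : sign_vector v ->
  gw_objective W (v *m v^T) = - \tr (D_of W v).
Proof.
move=> sv; apply/eqP; rewrite -addr_eq0.
have [_ v1] := sign_vector_feasible sv.
rewrite -(gw_objective_diag (diag_mx_is_diag _) v1).
by rewrite -gw_objectiveDl -quadratic_formE -mulmxA D_of_kernel // mulmx0 mxE.
Qed.

(** No entry of [v] vanishes, so row [i] of the eigenvector equation determines the [i]-th diagonal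
    entry: the diagonal shift of [W] that annihilates [v] is unique. *)
Lemma D_of_eigen W v (d : 'rV[R]_n) (lam : R) : sign_vector v ->
  (W + diag_mx d) *m v = lam *: v -> W + D_of W v = W + diag_mx d - lam%:M.
Proof.
move=> sv Wv; rewrite -addrA; congr (_ + _); apply/matrixP => i j; rewrite !mxE.
have [_|_] := eqVneq i j; last by rewrite subrr.
have /colP/(_ i) := Wv; rewrite mulmxDl mul_diag_mx !mxE => eqs.
rewrite !mulr1n (_ : \sum_j _ = (lam - d 0 i) * v i 0).
  by rewrite mulrCA mulNr sign_vector_sqr // mulrN1 opprB.
by rewrite mulrBl -eqs addrK.
Qed.

(** A separated pair changes its term from [W i j] to [- W i j], and it occurs in both orders; hence
    the factor 4. *)
Lemma char_vec_objective W T : W^T = W ->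
  gw_objective W (char_vec R T *m (char_vec R T)^T) =
  \sum_i \sum_j W i j - 4 * cut_value W T.
Proof.
move=> symW.
have symij i j : W i j = W j i by rewrite -[in LHS]symW mxE.
pose chi (b c : bool) : R := if b && ~~ c then 1 else 0.
have cutE : cut_value W T = \sum_i \sum_j chi (i \in T) (j \in T) * W i j.
  rewrite /cut_value big_mkcond; apply: eq_bigr => i _.
  rewrite big_mkcond; case: ifP => iT.
    apply: eq_bigr => j _; rewrite inE /chi.
    by case: (j \in T); rewrite /= ?mul0r ?mul1r.
  by rewrite big1 // => j _; rewrite /chi mul0r.
have cutE' : cut_value W T = \sum_i \sum_j chi (j \in T) (i \in T) * W i j.
  rewrite cutE exchange_big; apply: eq_bigr => i _.
  by apply: eq_bigr => j _; rewrite symij.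
have -> : 4 * cut_value W T = 2 * cut_value W T + 2 * cut_value W T by ring.
rewrite [X in _ - (2 * X + _)]cutE cutE' opprD !mulr_sumr addrA -!sumrB.
apply: eq_bigr => i _; rewrite !mulr_sumr -!sumrB; apply: eq_bigr => j _.
rewrite outerE !mxE /chi.
by case: (i \in T); case: (j \in T) => /=; ring.
Qed.

(** Every sign vector comes from the cut given by its positive entries, and the objective decreases
    as the cut value grows. *)
Lemma max_cut_objective W S u : W^T = W -> is_max_cut W S -> sign_vector u ->
  gw_objective W (char_vec R S *m (char_vec R S)^T) <= gw_objective W (u *m u^T).
Proof.
move=> symW maxS su.
have -> : u = char_vec R [set i | u i 0 == 1].
  apply/colP => i; rewrite mxE inE; case: eqP => // u1.
  by case: (su i).
by rewrite !char_vec_objective // lerD2l lerN2 ler_pM2l ?maxS ?ltr0n.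
Qed.

Lemma psd_of_primal_optimal W v : W^T = W -> sign_vector v ->
  gw_primal_optimal W (v *m v^T) -> psd (W + D_of W v).
Proof.
move=> symW sv [_ optv]; split=> [|x].
  by rewrite linearD /= symW tr_diag_mx.
rewrite leNgt; apply/negP; set q := (_ 0 0) => q0.
pose M := \sum_i (x i 0) ^+ 2.
pose K := \sum_i \sum_j `|W i j|.
(* In the denominator, [- q * M] ensures [tau * M <= 1], so that the square roots below make sense;
   [M ^+ 2 * K] keeps the second-order error below the gain [- q]; the 1 makes it positive. *)
pose tau := - q / (- q * M + M ^+ 2 * K + 1).
have M0 : 0 <= M by apply: sumr_ge0 => i _; exact: sqr_ge0.
have K0 : 0 <= K by do 2 (apply: sumr_ge0 => ? _).
have MK0 : 0 <= M ^+ 2 * K by rewrite mulr_ge0 ?sqr_ge0.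
have qM0 : 0 <= - q * M by rewrite mulr_ge0 // oppr_ge0 ltW.
have den0 : 0 < - q * M + M ^+ 2 * K + 1 by lra.
have tau0 : 0 < tau by rewrite divr_gt0 // oppr_gt0.
have tauM : tau * M <= 1.
  rewrite /tau mulrAC ler_pdivrMr // mul1r; lra.
have tauK : tau * (M ^+ 2 * K) < - q.
  rewrite /tau mulrAC ltr_pdivrMr // ltr_pM2l ?oppr_gt0 //; lra.
have xM i : (x i 0) ^+ 2 <= M.
  rewrite /M (bigD1 i) //= lerDl sumr_ge0 // => j _; exact: sqr_ge0.
(* [c i] is cos th_i. *)
pose c i := Num.sqrt (1 - tau * x i 0 ^+ 2).
have tx i : 0 <= tau * x i 0 ^+ 2 <= tau * M.
  by rewrite mulr_ge0 ?sqr_ge0 ?(ltW tau0) //= ler_pM2l ?xM.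
have c2 i : c i ^+ 2 = 1 - tau * x i 0 ^+ 2.
  by rewrite sqr_sqrtr //; have /andP[] := tx i; lra.
(* From [0 <= c i <= 1] follows [c i >= c i ^+ 2 >= 1 - tau * M]. All cosines thus lie within
   [tau * M] of each other, which makes the error quadratic in [tau]. *)
have c_bounds i : 1 - tau * M <= c i <= 1.
  have c0 : 0 <= c i by exact: sqrtr_ge0.
  have c1 : c i <= 1.
    by rewrite -(expr_le1 (n := 2)) // c2; have /andP[] := tx i; lra.
  have : c i ^+ 2 <= c i by rewrite expr2 ler_piMl.
  by rewrite c2; have /andP[] := tx i; lra.
have c_diff i j : (c i - c j) ^+ 2 <= (tau * M) ^+ 2.
  have /andP[? ?] := c_bounds i; have /andP[? ?] := c_bounds j.
  by rewrite -subr_ge0 subr_sqr mulr_ge0 //; lra.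
(* [Q] is the Gram matrix of the tilted unit vectors in the plane. *)
pose y := \col_i (v i 0 * c i).
pose Q := y *m y^T + tau *: (x *m x^T).
have QE i j : Q i j = v i 0 * c i * (v j 0 * c j) + tau * (x i 0 * x j 0).
  by rewrite mxE [X in _ + X]mxE !outerE !mxE.
have feasQ : gw_feasible Q.
  split; first by apply: psdD; [exact: psd_outer | apply: psdZ;
    [exact: ltW | exact: psd_outer]].
  move=> i; rewrite QE.
  have -> : v i 0 * c i * (v i 0 * c i) = v i 0 * v i 0 * c i ^+ 2 by ring.
  by rewrite sign_vector_sqr // c2; ring.
(* c_i c_j = (c_i^2 + c_j^2)/2 - (c_i - c_j)^2/2, and the first half sums to the
   contribution of D. *)
have QobjE : gw_objective W Q = gw_objective W (v *m v^T) + tau * q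
    - 2^-1 * \sum_i \sum_j W i j * (v i 0 * v j 0) * (c i - c j) ^+ 2.
  pose C i j := (1 - c i ^+ 2) * (W i j * (v i 0 * v j 0)).
  have DxE : tau * gw_objective (D_of W v) (x *m x^T) = - \sum_i \sum_j C i j.
    rewrite /gw_objective mulr_sumr -sumrN; apply: eq_bigr => i _.
    rewrite (bigD1 i) //= big1 ?addr0 => [|j ji].
      rewrite outerE !mxE eqxx mulr1n !mulr_sumr -sumrN.
      by apply: eq_bigr => j _; rewrite /C c2; ring.
    by rewrite [D_of _ _ _ _]mxE eq_sym (negbTE ji) mulr0n mulr0.
  have Csym : \sum_i \sum_j C i j = \sum_i \sum_j C j i by rewrite exchange_big.
  have -> : tau * q = tau * gw_objective W (x *m x^T)
      - (2^-1 * \sum_i \sum_j C i j + 2^-1 * \sum_i \sum_j C j i).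
    rewrite /q quadratic_formE gw_objectiveDl mulrDr DxE -Csym.
    by field.
  rewrite /gw_objective addrA !mulr_sumr -!big_split -!sumrB /=.
  apply: eq_bigr => i _; rewrite !mulr_sumr -!big_split -!sumrB /=.
  apply: eq_bigr => j _; rewrite QE /C !outerE.
  have -> : W j i = W i j by rewrite -[in LHS]symW mxE.
  by field.
have errE : - (\sum_i \sum_j W i j * (v i 0 * v j 0) * (c i - c j) ^+ 2)
    <= K * (tau * M) ^+ 2.
  rewrite -sumrN mulr_suml; apply: ler_sum => i _.
  rewrite -sumrN mulr_suml; apply: ler_sum => j _.
  rewrite -mulNr; apply: le_trans (ler_wpM2l (normr_ge0 _) (c_diff i j)).
  rewrite ler_wpM2r ?sqr_ge0 //; apply: le_trans (ler_norm _) _.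
  rewrite normrN !normrM.
  have norm_v k : `|v k 0| = 1 by case: (sv k) => ->; rewrite ?normrN normr1.
  by rewrite !norm_v !mulr1.
(* Optimality demands [tau * q - e / 2 >= 0], with [e] the error sum, whereas [- e] is at most
   [tau * (tau * (M ^+ 2 * K))], which is below [- tau * q]. *)
have := optv Q feasQ; rewrite QobjE.
have : tau * (tau * (M ^+ 2 * K)) < tau * - q by rewrite ltr_pM2l.
move: errE; rewrite exprMn.
set e := \sum_i _; set G := gw_objective _ _.
have -> : K * (tau ^+ 2 * M ^+ 2) = tau * (tau * (M ^+ 2 * K)) by ring.
have : 0 <= tau * (tau * (M ^+ 2 * K)) by do 2 (apply: mulr_ge0; first exact: ltW).
rewrite mulrN; lra.
Qed.

End SignVectors.

Theorem theorem7 (R : realType) (n : nat) (W : 'M[R]_n) (S : {set 'I_n}) :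
  (0 < n)%N ->
  maxcut_instance W -> is_max_cut W S ->
  let v := char_vec R S in
  let D := D_of W v in
  [/\ (gw_bipolar W <-> generalized_least_eigenvector W v),
      (generalized_least_eigenvector W v <-> psd (W + D)) &
      (psd (W + D) <-> gw_dual_optimal W (- D))].
Proof.
move=> n0 [symW _] maxS v D.
have sv : sign_vector v := sign_char_vec R S.
have [_ v1] := sign_vector_feasible sv.
have diagD : is_diag_mx D by exact: diag_mx_is_diag.
have WDv : (W + D) *m v = 0 := D_of_kernel W sv.
have objv : gw_objective W (v *m v^T) = - \tr D := D_of_objective W sv.
have symWD : (W + D)^T = W + D by rewrite linearD /= symW tr_diag_mx.
have vN0 : v != 0.
  (* An index exists because [n] is positive; the entry there squares to 1. *)
  apply/eqP => /colP/(_ (Ordinal n0)) v0; have := sign_vector_sqr (Ordinal n0) sv.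
  by rewrite v0 mxE mul0r => /esym/eqP; rewrite oner_eq0.
have bipolarP : gw_bipolar W <-> psd (W + D).
  split=> [[u [su [_ optu]]] | pWD].
    apply: psd_of_primal_optimal => //; split; first exact: sign_vector_feasible.
    move=> Q /optu; apply: le_trans; exact: max_cut_objective.
  exists v; split=> //; split; first exact: sign_vector_feasible.
  move=> Q [pQ Q1]; have := psd_objective_ge0 pWD pQ.
  by rewrite gw_objectiveDl (gw_objective_diag diagD) // objv -lerBlDr sub0r.
have eigenP : generalized_least_eigenvector W v <-> psd (W + D).
  split=> [[d [_ [lam [Wv leastlam]]]] | pWD].
    have WDE : W + D = W + diag_mx d - lam%:M := D_of_eigen sv Wv.
    (* An eigenvalue [mu] of [W + D] is an eigenvalue [mu + lam] of [W + diag_mx d], so leastness of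
       [lam] gives [0 <= mu]. *)
    apply: psd_of_eigenvalues => // mu x x0.
    rewrite WDE mulmxBl mul_scalar_mx => /eqP; rewrite subr_eq => /eqP.
    by rewrite -scalerDl => /(leastlam _ _ x0); rewrite lerDr.
  exists (\row_i (- v i 0 * \sum_j W i j * v j 0)); split=> //.
  exists 0; split; first by rewrite scale0r.
  by move=> mu x; exact: psd_eigenvalue_ge0.
split; [by rewrite bipolarP eigenP | exact: eigenP |].
split=> [pWD | [_ [+ _]]]; last by rewrite opprK.
split; first by rewrite -linearN diag_mx_is_diag.
split=> [|E diagE [_ /(_ v)]]; first by rewrite opprK.
(* Evaluated at [v], the form of [W - E] equals [- \tr D - \tr E]. *)
rewrite quadratic_formE gw_objectiveDl gw_objectiveNl objv linearN /=.
by rewrite (gw_objective_diag diagE) // subr_ge0.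
Qed.
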